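(* Let $(X,\|\cdot\|,\preceq)$ be a Banach space endowed with a partial order $\preceq$ for which all order intervals $[a,\rightarrow)$ and $(\leftarrow,b]$ ($a,b\in X$) are convex and closed. Assume that $(X,\|\cdot\|)$ is uniformly convex. Let $C$ be a nonempty convex closed bounded subset of $X$ not reduced to one point. Let $T: C\rightarrow C$ be a continuous monotone asymptotic nonexpansive mapping. Then $T$ has a fixed point if and only if there exists $x_0\in C$ such that $x_0$ and $T(x_0)$ are comparable.
   Context: The partial order $\preceq$ on $X$ is not assumed to have any compatibility with the linear structure or the norm beyond what is stated. Two elements $x,y$ are comparable if $x\preceq y$ or $y\preceq x$. Order intervals are the sets $[a,\rightarrow)=\{x\in X:\ a\preceq x\}$ and $(\leftarrow,b]=\{x\in X:\ x\preceq b\}$ for $a,b\in X$. The Banach space $X$ is uniformly convex if for every $\varepsilon>0$, $\delta(\varepsilon)=\inf\{1-\|\frac{x+y}{2}\|:\ \|x\|\le 1,\ \|y\|\le 1,\ \|x-y\|\ge\varepsilon\}>0$ (with $\inf\emptyset=+\infty$). A map $T:C\to C$ is monotone if $x\preceq y$ implies $T(x)\preceq T(y)$ for all $x,y\in C$. $T$ is a monotone asymptotic nonexpansive mapping if $T$ is monotone and there exists a sequence $\{k_n\}$ of positive numbers with $\lim_{n\to+\infty}k_n=1$ such that $\|T^n(x)-T^n(y)\|\le k_n\|x-y\|$ for every $n$ and all comparable $x,y\in C$. A fixed point of $T$ is a point $x\in C$ with $T(x)=x$. *)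

(* Defs.v *)
From mathcomp Require Import all_boot all_order all_algebra.
From mathcomp Require Import all_classical all_reals all_analysis.
Import Order.TTheory GRing.Theory Num.Theory.
Import numFieldNormedType.Exports.

Set Implicit Arguments.
Unset Strict Implicit.
Unset Printing Implicit Defensive.

Local Open Scope classical_set_scope.
Local Open Scope ring_scope.

Section orders.
Variables (X : Type) (le : rel X).

Definition partial_order : Prop :=
  [/\ reflexive le, antisymmetric le & transitive le].

Definition order_comparable (x y : X) : Prop := le x y \/ le y x.

Definition interval_from (a : X) : set X := [set x | le a x].

Definition interval_to (b : X) : set X := [set x | le x b].

End orders.

(* Valued in the extended reals: the infimum of the empty set is +oo. *)
Definition modulus_of_convexity (R : realType) (X : normedModType R) (e : R)
    : \bar R :=
  ereal_inf [set r : \bar R | exists x y : X,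
    [/\ `|x| <= 1, `|y| <= 1, e <= `|x - y| &
        r = (1 - `|2^-1 *: (x + y)|)%:E]].

Definition uniformly_convex (R : realType) (X : normedModType R) : Prop :=
  forall e : R, 0 < e -> (0 < modulus_of_convexity X e)%E.

(* A map C -> C is represented by T : X -> X with set_fun C C T; the values of
   T outside C are never used. *)
Definition monotone_on (X : Type) (le : rel X) (C : set X) (T : X -> X) : Prop :=
  forall x y : X, C x -> C y -> le x y -> le (T x) (T y).

(* Sequences are indexed by n >= 1, so the term k 0 plays no role in the
   estimate. *)
Definition monotone_asymptotic_nonexpansive (R : realType)
    (X : normedModType R) (le : rel X) (C : set X) (T : X -> X) : Prop :=
  monotone_on le C T /\
  exists k : R^nat,
    [/\ forall n, 0 < k n,
        k @ \oo --> (1 : R) &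
        forall n : nat, (0 < n)%N -> forall x y : X, C x -> C y ->
          order_comparable le x y -> `|iter n T x - iter n T y| <= k n * `|x - y|].

(* Main.v *)
(** Suppose [x0 <= T x0]; otherwise reverse the order.  The orbit [u n = T^n x0]
    is increasing and the sets [K n = C /\ [u n, ->)] are closed, convex and
    decreasing.  Let [d] be the infimum of the [r] such that every [K n] contains points
    [y] with [limsup |u m - y| <= r].  By uniform convexity the midpoint of two
    far apart points of [K n] that nearly achieve [d] would beat [d], so nearly
    optimal points of [K n] are close to each other for large [n].  Completeness
    then yields [z] in all [K n] with [limsup |u m - z| <= d].  The iterates
    [T^m z] stay in every [K n] and [limsup_n |u n - T^m z| <= k m * d], so they
    are nearly optimal too; hence [T^m z --> z], and [T z = z] by continuity. *)
Require Import Defs.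
From mathcomp Require Import all_boot all_order all_algebra.
From mathcomp Require Import all_classical all_reals all_analysis.
From mathcomp Require Import lra.
Import Order.TTheory GRing.Theory Num.Theory.
Import numFieldNormedType.Exports.

Local Open Scope classical_set_scope.
Local Open Scope ring_scope.

Lemma uniformly_convex_midpoint (R : realType) (X : normedModType R) (e : R) :
  uniformly_convex X -> 0 < e ->
  exists2 d : R, 0 < d & forall x y : X, `|x| <= 1 -> `|y| <= 1 ->
    e <= `|x - y| -> `|2^-1 *: (x + y)| <= 1 - d.
Proof.
move=> /[apply]; rewrite /modulus_of_convexity; set S := (X in ereal_inf X) => S0.
have Sge d : (d%:E <= ereal_inf S)%E -> forall x y : X, `|x| <= 1 -> `|y| <= 1 ->
    e <= `|x - y| -> `|2^-1 *: (x + y)| <= 1 - d.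
  move=> dS x y x1 y1 exy; rewrite lerBrDl addrC -lerBrDl -lee_fin.
  by apply: (le_trans dS); apply: ereal_inf_lbound; exists x, y.
case: (ereal_inf S) S0 Sge => [d|_ Sge|//].
- by rewrite lte_fin => d0 Sge; exists d => //; exact: Sge.
(* The infimum is [+oo] when no two points of the unit ball are [e] apart; any [d] would do. *)
- by exists 1 => //; apply: Sge; rewrite leey.
Qed.

(** Translating by [a] and dividing by [r] reduces to the unit ball. The separation becomes
    [e / r >= e / r0], so a single [d] serves every radius up to [r0]. *)
Lemma uniformly_convex_midpoint_dist (R : realType) (X : normedModType R)
    (r0 e : R) :
  uniformly_convex X -> 0 < r0 -> 0 < e ->
  exists2 d : R, 0 < d & forall (a x y : X) (r : R), r <= r0 ->
    `|a - x| <= r -> `|a - y| <= r -> e <= `|x - y| ->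
    `|a - 2^-1 *: (x + y)| <= r * (1 - d).
Proof.
move=> Xuc r00 e0.
have [d d0 dP] := @uniformly_convex_midpoint R X (e / r0) Xuc (divr_gt0 e0 r00).
exists d => // a x y r rr0 ax ay exy.
have r_ge0 : 0 <= r := le_trans (normr_ge0 _) ax.
have r_gt0 : 0 < r.
  have := ler_distD a x y; rewrite (distrC x a) => xy.
  by rewrite lt_neqAle r_ge0 andbT; apply/eqP => r0E; lra.
have scale_norm (v : X) : `|r^-1 *: v| = `|v| / r.
  by rewrite normrZ gtr0_norm ?invr_gt0// mulrC.
have scale_le1 (v : X) : `|v| <= r -> `|r^-1 *: v| <= 1.
  by rewrite scale_norm ler_pdivrMr// mul1r.
have := dP _ _ (scale_le1 _ ax) (scale_le1 _ ay).
rewrite -scalerBr -scalerDr scalerA (mulrC 2^-1) -scalerA !scale_norm.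
have -> : a - x - (a - y) = - (x - y) by rewrite !opprB addrC addrA subrK.
have -> : 2^-1 *: (a - x + (a - y)) = a - 2^-1 *: (x + y).
  rewrite addrACA -opprD scalerBr; congr (_ - _).
  by rewrite scalerDr -scalerDl -[RHS]scale1r; congr (_ *: _); lra.
rewrite normrN (ler_pdivrMr _ _ r_gt0) (mulrC _ r); apply.
by rewrite ler_pM ?invr_ge0 ?(ltW e0) ?(ltW r00)// lef_pV2 ?posrE.
Qed.

Lemma convex_set_midpoint (R : realType) (X : normedModType R) (A : set X)
    (x y : X) :
  convex_set A -> A x -> A y -> A (2^-1 *: (x + y)).
Proof.
move=> Acv Ax Ay.
have half01 : Itv.spec (@Itv.num_sem R) (Itv.Real `[0%Z, 1%Z]) (2^-1 : R).
  by apply/andP; split; rewrite ?num_real//= in_itv/=; lra.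
have := Acv x y (Itv.mk half01); rewrite !inE => /(_ Ax Ay).
congr A; rewrite scalerDr; congr (_ + _ *: _).
by rewrite /= /unstable.onem; lra.
Qed.

Definition eventually_within {R : realType} {X : normedModType R}
    (u : nat -> X) (y : X) (r : R) : Prop :=
  \forall n \near \oo, `|u n - y| <= r.

(* The least asymptotic radius of [u] on [K n], in the limit of large [n] when
   [K] is decreasing; phrased with "eventually" so that no limsup is needed. *)
Definition limit_radius {R : realType} {X : normedModType R}
    (K : nat -> set X) (u : nat -> X) : R :=
  inf [set r | forall n, exists2 y, K n y & eventually_within u y r].

Section asymptotic_center.
Variables (R : realType) (X : completeNormedModType R).
Hypothesis X_uc : uniformly_convex X.
Variables (K : nat -> set X) (u : nat -> X).
Hypothesis K_ex : exists r, forall n, exists2 y, K n y & eventually_within u y r.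
Hypothesis K_decr : forall n m, (n <= m)%N -> K m `<=` K n.
Hypothesis K_closed : forall n, closed (K n).
Hypothesis K_mid : forall n x y, K n x -> K n y -> K n (2^-1 *: (x + y)).

Local Notation d := (limit_radius K u).
Let S := [set r | forall n, exists2 y, K n y & eventually_within u y r].

Let S_lb : lbound S 0.
Proof.
move=> r /(_ 0%N)[y _ [N _ /(_ N (leqnn N))]].
exact: le_trans (normr_ge0 _).
Qed.

Let has_inf_S : has_inf S.
Proof. by split=> //; exists 0. Qed.

Lemma limit_radius_ge0 : 0 <= d.
Proof. exact: lb_le_inf. Qed.

Lemma eventually_within_le y r s :
  r <= s -> eventually_within u y r -> eventually_within u y s.
Proof. by move=> rs; apply: filterS => n /le_trans; apply. Qed.

Lemma limit_radius_approx e n : 0 < e ->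
  exists2 y, K n y & eventually_within u y (d + e).
Proof.
move=> /inf_adherent /(_ has_inf_S)[r /(_ n)[y Ky yr] rlt].
by exists y => //; apply: eventually_within_le yr; exact: ltW.
Qed.

(** Otherwise [d - e] would belong to the set whose infimum is [d]. *)
Lemma limit_radius_far e : 0 < e ->
  exists N, forall y, K N y -> ~ eventually_within u y (d - e).
Proof.
move=> e0; apply: contrapT => /forallNP H; have : d <= d - e; last by lra.
apply: ge_inf; first by exists 0.
by move=> n; have /existsNP[y /not_implyP[Ky /contrapT yd]] := H n; exists y.
Qed.

Lemma limit_radius_diam e : 0 < e ->
  exists2 eta, 0 < eta & exists N, forall y y', K N y -> K N y' ->
    eventually_within u y (d + eta) -> eventually_within u y' (d + eta) ->
    `|y - y'| <= e.
Proof.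
(* For [d = 0] the convexity gain [d * delta] vanishes, but the triangle inequality through a common
   [u n] suffices. *)
move=> e0; have [d0|d_neq0] := eqVneq d 0.
  exists (e / 2); first by lra.
  exists 0%N => y y' _ _ yd y'd; have [n []] := filter_ex (filterI yd y'd).
  rewrite d0 add0r => un un'; have := ler_distD (u n) y y'.
  by rewrite (distrC y (u n)); lra.
have d_gt0 : 0 < d by rewrite lt_neqAle eq_sym d_neq0 limit_radius_ge0.
have [|delta delta0 deltaP] :=
  @uniformly_convex_midpoint_dist R X (d + 1) e X_uc _ e0; first by lra.
have ddelta : 0 < d * delta by rewrite mulr_gt0.
(* The bound [1] keeps [d + eta] within the radius for which [delta] was chosen; the other bound
   gives [(d + eta) * (1 - delta) <= d - eta], which [limit_radius_far] forbids for the midpoint. *)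
pose eta := Num.min 1 (d * delta / 2).
have eta0 : 0 < eta by rewrite lt_min ltr01/= divr_gt0.
have eta1 : eta <= 1 by rewrite ge_min lexx.
have eta2 : eta <= d * delta / 2 by rewrite ge_min lexx orbT.
exists eta => //; have [N far] := limit_radius_far _ eta0.
exists N => y y' Ky Ky' yd y'd; rewrite leNgt; apply/negP => eyy'.
apply: (far _ (K_mid _ _ _ Ky Ky')); apply: filterS2 yd y'd => n uy uy'.
apply: (le_trans (deltaP _ _ _ (d + eta) _ uy uy' (ltW eyy'))); first by lra.
have : 0 <= eta * delta by rewrite mulr_ge0 ?ltW.
by nra.
Qed.

Lemma asymptotic_center_exists :
  exists2 z, (forall n, K n z) &
    forall eta, 0 < eta -> eventually_within u z (d + eta).
Proof.
have /choice[y yP] : forall n, exists y,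
    K n y /\ eventually_within u y (d + n.+1%:R^-1).
  by move=> n; have [|y] := @limit_radius_approx n.+1%:R^-1 n;
    [rewrite invr_gt0 | exists y].
have y_within eta : 0 < eta ->
    \forall n \near \oo, eventually_within u (y n) (d + eta).
  move=> eta0; have := near_infty_natSinv_lt (PosNum eta0).
  apply: filterS => n /ltW neta; apply: eventually_within_le (yP n).2.
  by rewrite lerD2l.
have /cvg_ex[z yz] : cvg (y @ \oo).
  apply/cauchy_cvgP/cauchy_exP => e e0.
  have [|eta eta0 [N diam]] := limit_radius_diam (e / 2); first by lra.
  have [M _ Mw] := y_within _ eta0; exists (y (maxn N M)).
  exists (maxn N M) => // n /= nNM; rewrite -ball_normE /=.
  apply: (@le_lt_trans _ _ (e / 2)); last by lra.
  move: nNM; rewrite geq_max => /andP[Nn Mn].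
  apply: diam; [| | apply: Mw; exact: leq_maxr | exact: Mw].
  - exact: K_decr (leq_maxl N M) _ (yP _).1.
  - exact: K_decr Nn _ (yP _).1.
exists z => [n|eta eta0].
  apply: (closed_cvg (K n) (K_closed n) _ z yz).
  by exists n => // m nm; exact: K_decr nm _ (yP _).1.
have eta20 : 0 < eta / 2 by lra.
(* One [y m] that is both close to [z] and nearly optimal passes its bound on to [z]. *)
have /cvgrPdist_le/(_ _ eta20) zy := yz.
have [m [zym ym]] := filter_ex (filterI zy (y_within _ eta20)).
apply: filterS ym => n uy; have := ler_distD (y m) (u n) z.
by rewrite (distrC (y m)); lra.
Qed.

(** For large [m], [w m] and [z] are both nearly optimal points of the same [K N], hence close by
    [limit_radius_diam]. *)
Lemma asymptotic_center_cvg z (w : nat -> X) :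
  (forall n, K n z) -> (forall eta, 0 < eta -> eventually_within u z (d + eta)) ->
  (forall m n, K n (w m)) ->
  (forall eta, 0 < eta ->
    \forall m \near \oo, eventually_within u (w m) (d + eta)) ->
  w @ \oo --> z.
Proof.
move=> Kz zd Kw wd; apply/cvgrPdist_le => e /limit_radius_diam[eta eta0 [N diam]].
by apply: filterS (wd _ eta0) => m wm; apply: diam => //; exact: zd.
Qed.

End asymptotic_center.

Lemma fixed_point_of_le (R : realType) (X : completeNormedModType R) (le : rel X)
    (C : set X) (T : X -> X) (x0 : X) :
  reflexive le -> transitive le ->
  (forall a, convex_set (interval_from le a) /\ closed (interval_from le a)) ->
  uniformly_convex X -> convex_set C -> closed C -> bounded_set C ->
  set_fun C C T -> {within C, continuous T} ->
  monotone_asymptotic_nonexpansive le C T ->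
  C x0 -> le x0 (T x0) -> exists x, C x /\ T x = x.
Proof.
move=> le_refl le_trans from_cc Xuc C_cvx C_cl C_bnd CT T_cont.
move=> [T_mono [k [k_gt0 k1 kP]]] Cx0 x0T.
pose u n := iter n T x0.
have C_iter n x : C x -> C (iter n T x).
  by move=> Cx; elim: n => //= n IH; exact: CT.
have Cu n : C (u n) by exact: C_iter.
have u_step n : le (u n) (u n.+1) by elim: n => // n; exact: T_mono.
have u_incr n m : (n <= m)%N -> le (u n) (u m).
  move=> /subnK <-; elim: (m - n)%N => [|p IH]; first exact: le_refl.
  exact: le_trans IH (u_step _).
pose K n := C `&` interval_from le (u n).
have K_ex : exists r, forall n, exists2 y, K n y & eventually_within u y r.
  have [M [_ MP]] := C_bnd; pose B := M + 1.
  have CB x : C x -> `|x| <= B by apply: MP; rewrite ltrDl.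
  exists (B + B) => n; exists (u n); first by split=> //; exact: le_refl.
  apply: nearW => m; apply: (Order.POrderTheory.le_trans (ler_normB _ _)).
  by rewrite lerD ?CB.
have K_decr n m : (n <= m)%N -> K m `<=` K n.
  by move=> nm x [Cx umx]; split=> //; exact: le_trans (u_incr _ _ nm) umx.
have K_closed n : closed (K n) by apply: closedI => //; exact: (from_cc _).2.
have K_mid n x y : K n x -> K n y -> K n (2^-1 *: (x + y)).
  move=> [Cx ux] [Cy uy]; split; first exact: convex_set_midpoint.
  by apply: convex_set_midpoint => //; exact: (from_cc _).1.
have [z Kz zd] := asymptotic_center_exists _ _ Xuc _ _ K_ex K_decr K_closed K_mid.
have Cz : C z := (Kz 0%N).1.
have K_iter m n : K n (iter m T z).
  elim: m n => // m IH n; split; first by apply: CT; exact: (IH 0%N).1.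
  (* Monotonicity gives [T (u n) <= T (T^m z)], and [u n <= T (u n)] brings the index back to
     [n]. *)
  apply: le_trans (u_step n) _.
  by apply: T_mono => //; [exact: (IH 0%N).1 | exact: (IH n).2].
have iter_within eta : 0 < eta -> \forall m \near \oo,
    eventually_within u (iter m T z) (limit_radius K u + eta).
  move=> eta0; set d := limit_radius K u.
  have d0 : 0 <= d by exact: limit_radius_ge0.
  have [e e0 eP] : exists2 e, 0 < e & (1 + e) * (d + e) <= d + eta.
    (* With [e <= 1], [(1 + e) * (d + e) = d + e * (d + 1 + e) <= d + e * (d + 2)]. *)
    exists (Num.min 1 (eta / (d + 2))); first by rewrite lt_min ltr01 divr_gt0//; lra.
    set e := Num.min _ _; have e1 : e <= 1 by rewrite ge_min lexx.
    have e0 : 0 <= e by rewrite le_min ler01 divr_ge0 ?ltW//; lra.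
    have : e * (d + 2) <= eta by rewrite -ler_pdivlMr; [rewrite ge_min lexx orbT | lra].
    by nra.
  have /cvgrPdist_le/(_ _ e0) k1e := k1.
  apply: filterS2 k1e (nbhs_infty_gt 0) => m km m0.
  have [N _ zN] := zd _ e0.
  exists (N + m)%N => // n /= Nmn.
  (* Since [u (n - m) <= z], the estimate for [T^m] applies to this pair, and [n - m >= N] bounds
     their distance by [d + e]. *)
  have -> : u n = iter m T (u (n - m)%N).
    by rewrite /u -iterD subnKC// (leq_trans _ Nmn)// leq_addl.
  apply: (Order.POrderTheory.le_trans (kP m m0 _ _ (Cu _) Cz (or_introl (Kz _).2))).
  apply: Order.POrderTheory.le_trans eP.
  apply: ler_pM => //; [exact: ltW | | ].
  - by move: km; rewrite ler_distl; lra.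
  - by apply: zN => /=; rewrite -(leq_add2r m) subnK// (leq_trans _ Nmn)// leq_addl.
have Tz := asymptotic_center_cvg _ _ Xuc _ _ K_ex K_mid _ _ Kz zd K_iter iter_within.
exists z; split=> //.
have Twithin : T x @[x --> within C (nbhs z)] --> T z.
  by have := (subspace_continuousP C T).1 T_cont z Cz.
(* [T] is continuous only relative to [C], so the convergence of the iterates is restated in the
   filter restricted to [C]. *)
have iter_in : iter m T z @[m --> \oo] --> within C (nbhs z).
  move=> P /Tz PT; have : \forall m \near \oo, C (iter m T z) -> P (iter m T z) := PT.
  by apply: filterS => m; apply; exact: C_iter.
have TTz := cvg_comp _ _ iter_in Twithin.
apply: (cvg_unique (@norm_hausdorff _ X) TTz).
have : [sequence iter n.+1 T z]_n @ \oo --> z by rewrite (cvg_shiftS (fun n => iter n T z)).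
by [].
Qed.

Theorem theorem3p3 (R : realType) (X : completeNormedModType R) (le : rel X)
  (le_order : partial_order le)
  (from_convex_closed : forall a : X,
     convex_set (interval_from le a) /\ closed (interval_from le a))
  (to_convex_closed : forall b : X,
     convex_set (interval_to le b) /\ closed (interval_to le b))
  (X_uc : uniformly_convex X)
  (C : set X) (C_nonempty : C !=set0) (C_convex : convex_set C)
  (C_closed : closed C) (C_bounded : bounded_set C)
  (C_not_point : forall x : X, C <> [set x])
  (T : X -> X) (T_maps : set_fun C C T)
  (T_continuous : {within C, continuous T})
  (T_man : monotone_asymptotic_nonexpansive le C T) :
  (exists x : X, C x /\ T x = x) <->
  (exists x0 : X, C x0 /\ order_comparable le x0 (T x0)).
Proof.
split=> [[x [Cx Tx]]|[x0 [Cx0 x0_cmp]]].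
  by exists x; split=> //; left; rewrite Tx; case: le_order => ->.
have [le_refl _ le_trans] := le_order.
case: x0_cmp => x0T; first exact: (fixed_point_of_le _ _ le C T x0).
(* In the reversed order, the upward intervals are the sets [interval_to le b]. *)
apply: (fixed_point_of_le _ _ (fun x y => le y x) C T x0) => //.
- by move=> y x z yx zy; exact: le_trans zy yx.
- have [T_mono [k [k_gt0 k1 kP]]] := T_man.
  split; first by move=> x y Cx Cy; exact: T_mono.
  exists k; split=> // n n0 x y Cx Cy xy; apply: kP => //.
  by case: xy; [right | left].
Qed.
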